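(* Let $A$ be an unrooted directed tree and let $\lambda=(\lambda_v)_{v\in A}$ be a weight such that the induced weighted backward shift $B_\lambda:c_0(A)\to c_0(A)$ is bounded. Suppose that there is a sequence of non-negative integers $(n_k)_{k\ge1}$ such that, for every $v\in A$, $$\sum_{u\in\mathrm{Chi}^{n_k}(v)}|\lambda(v\to u)|\xrightarrow{k\to+\infty}+\infty\quad\text{and}\quad\lambda(\mathrm{par}^{n_k}(v)\to v)\xrightarrow{k\to+\infty}0.$$ Then $B_\lambda$ has a dense, countably generated, free hypercyclic algebra.
   Context: All scalars are complex. A directed tree is a connected directed graph $(A,E)$ with countable vertex set $A$ and edge set $E\subset\{(a,b)\in A\times A: a\ne b\}$, having no cycles, and such that each vertex $b$ has at most one parent, i.e. a vertex $a=\mathrm{par}(b)$ with $(a,b)\in E$. The tree is unrooted if every vertex has a parent. $\mathrm{par}^0(b)=b$ and $\mathrm{par}^k(b)=\mathrm{par}(\mathrm{par}^{k-1}(b))$. $\mathrm{Chi}(v)$ is the set of children of $v$ (vertices whose parent is $v$), $\mathrm{Chi}^0(v)=\{v\}$, $\mathrm{Chi}^n(v)=\bigcup_{u\in\mathrm{Chi}^{n-1}(v)}\mathrm{Chi}(u)$. All trees are assumed leafless: every vertex has at least one child (possibly infinitely many). A weight is a family $\lambda=(\lambda_v)_{v\in A}$ of non-zero scalars. The weighted backward shift is $(B_\lambda f)(v)=\sum_{u\in\mathrm{Chi}(v)}\lambda_uf(u)$ for $v\in A$. For $u\in\mathrm{Chi}^n(v)$, $n\ge0$, put $\lambda(v\to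 u)=\prod_{k=0}^{n-1}\lambda_{\mathrm{par}^k(u)}$ (equal to $1$ if $n=0$). $c_0(A)$ is the space of $f\in\mathbb{C}^A$ such that for every $\varepsilon>0$ there is a finite $F\subset A$ with $|f(v)|<\varepsilon$ for all $v\in A\setminus F$, with the sup norm; it is a Banach algebra for the coordinatewise product $(fg)(v)=f(v)g(v)$. $HC(T)$ is the set of hypercyclic vectors of $T$, i.e. vectors $x$ whose orbit $\{T^nx:n\ge0\}$ is dense. A hypercyclic algebra for $T$ is a subalgebra, not $\{0\}$, contained in $HC(T)\cup\{0\}$. It is dense if it is dense in the whole space, and countably generated and free if it is generated by a countably infinite set $G$ that is algebraically independent: $P(g_1,\dots,g_d)\ne0$ for all $d\geq 1$, distinct $g_1,\dots,g_d\in G$ and every non-zero polynomial $P$ in $d$ commuting variables without constant term. *)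

(* Defs.v *)
(* The complex scalars are R[i] for R : realType. *)
From mathcomp Require Import all_boot all_order all_algebra finmap.
From mathcomp Require Import complex.
From mathcomp Require Import all_classical all_reals all_analysis.
(* The names and notations of [mpoly] and [showcase.summability] clash with
   those of the libraries above. *)
From mathcomp Require Import(coercions,canonicals) mpoly.
From mathcomp.analysis.showcase Require summability.

Set Implicit Arguments.
Unset Strict Implicit.
Unset Printing Implicit Defensive.

Import Order.TTheory GRing.Theory Num.Theory.
Import numFieldNormedType.Exports.

Local Open Scope classical_set_scope.
Local Open Scope ring_scope.

(** Directed trees: [E a b] says that (a, b) is an edge. *)

Section Tree.
Context {A : countType} (E : rel A).

Record directed_tree : Prop := DirectedTree {
  (* connected graphs are non-empty *)
  tree_nonempty : exists a : A, True;
  tree_irreflexive : forall a, ~~ E a a;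
  tree_connected : forall a b, exists2 p : seq A,
    path (fun x y => E x y || E y x) a p & last a p = b;
  (* [ucycle] also accepts the empty sequence *)
  tree_acyclic : forall s : seq A, ucycle E s -> s = [::];
  tree_parent_uniq : forall a a' b, E a b -> E a' b -> a = a' }.

Definition unrooted := forall b, exists a, E a b.

Definition leafless := forall a, exists b, E a b.

(* The value at a root is irrelevant (it is the root itself). *)
Definition par (b : A) : A := xget b [set a | E a b].

Definition Chi (v : A) : set A := [set u | E v u].

Fixpoint Chin (n : nat) (v : A) : set A :=
  if n is m.+1 then \bigcup_(u in Chin m v) Chi u else [set v].

End Tree.

Section Shift.
Context {R : realType} {A : countType} (E : rel A).
Implicit Types (lambda f : A -> R[i]).

(* lambda(v -> u) for u in Chi^n(v); in a tree, v is par^n(u), so that only n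
   and u are needed. *)
Definition path_weight lambda (n : nat) (u : A) : R[i] :=
  \prod_(k < n) lambda (iter k (par E) u).

(* Chi(v) may be infinite: [shift_term lambda f v] is the family
   (lambda_u f(u)) for u in Chi(v), extended by 0 to A, and [summability.sum]
   is the limit of its partial sums along the finite subsets of A. As a
   normed space over itself, R[i] is denoted by R[i]^o. *)
Definition shift_term lambda f (v : A) : A -> R[i] :=
  patch (fun=> 0) (Chi E v) (fun u => lambda u * f u).

Definition backward_shift lambda f : A -> R[i] :=
  fun v => summability.sum (shift_term lambda f v : A -> R[i]^o).

End Shift.

Section C0.
Context {R : realType} {A : countType}.
Implicit Types (f g : A -> R[i]) (M S : set (A -> R[i])).
Implicit Types (T : (A -> R[i]) -> (A -> R[i])).

Definition c0 : set (A -> R[i]) :=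
  [set f | forall e : R, 0 < e ->
     exists2 F : set A, finite_set F & forall v, ~ F v -> Normc.normc (f v) < e].

(* Meaningful for bounded f only; elements of c0 are bounded. *)
Definition supnorm f : R := sup (range (fun v => Normc.normc (f v))).

(* Density in c0 of a subset S of c0. *)
Definition dense_c0 S := forall f (e : R), c0 f -> 0 < e ->
  exists2 g, S g & supnorm (g - f) < e.

(* T maps c0 to itself, and is bounded on it. *)
Definition bounded_c0 T :=
  (forall f, c0 f -> c0 (T f)) /\
  exists K : R, forall f, c0 f -> supnorm (T f) <= K * supnorm f.

Definition HC T : set (A -> R[i]) :=
  [set f | c0 f /\ dense_c0 (range (fun n : nat => iter n T f))].

(* The ring operations on A -> R[i] are the coordinatewise ones. *)
Record subalgebra_c0 M : Prop := SubalgebraC0 {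
  subalgebra_sub : M `<=` c0;
  subalgebra_0 : M 0;
  subalgebra_add : forall f g, M f -> M g -> M (f + g);
  subalgebra_scale : forall (c : R[i]) f, M f -> M (c *: f);
  subalgebra_mul : forall f g, M f -> M g -> M (f * g) }.

Definition hypercyclic_algebra T M :=
  [/\ subalgebra_c0 M, M != [set 0] & M `<=` HC T `|` [set 0]].

(* [mpoly.mnm0] is the trivial monomial, so the penultimate hypothesis says
   that P has no constant term; then P(g_1, ..., g_d) is the coordinatewise
   evaluation of P. *)
Definition algebraically_independent (G : set (A -> R[i])) :=
  forall (d : nat) (g : 'I_d -> A -> R[i]), (0 < d)%N -> injective g ->
    (forall i, G (g i)) ->
  forall P : mpoly.mpoly d R[i],
    mpoly.mcoeff mpoly.mnm0 P = 0 -> P != 0 ->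
    (fun v => mpoly.meval (fun i => g i v) P) != 0 :> (A -> R[i]).

(* [smallest subalgebra_c0 G] is the subalgebra generated by G. *)
Definition countably_generated_free M :=
  exists G : set (A -> R[i]),
    [/\ (G #= [set: nat])%card, G `<=` c0, algebraically_independent G
      & M = smallest subalgebra_c0 G].

End C0.

(* B_lambda is well defined and bounded from c0 to c0. *)
Definition bounded_backward_shift (R : realType) (A : countType) (E : rel A)
    (lambda : A -> R[i]) :=
  (forall f v, c0 f ->
     cvg (summability.partial_sum (shift_term E lambda f v : A -> R[i]^o)
          @ summability.totally)) /\
  bounded_c0 (backward_shift E lambda).

(* Main.v *)
Require Import Defs.
From mathcomp Require Import all_boot all_order all_algebra finmap.
From mathcomp Require Import complex.
From mathcomp Require Import all_classical all_reals all_analysis.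
From mathcomp Require Import(coercions,canonicals) mpoly.
From mathcomp Require Import ring lra.
Set Implicit Arguments.
Unset Strict Implicit.
Unset Printing Implicit Defensive.
Import Order.TTheory GRing.Theory Num.Theory.
Import numFieldNormedType.Exports.
Local Open Scope classical_set_scope.
Local Open Scope ring_scope.

(** The hypercyclic algebra is generated by explicit vectors f_0, f_1, ...; no
    Baire category argument is involved. Write T for the shift and
    p_N(u) = lambda(par^N(u) -> u), so that (T^N g)(v) is the sum of p_N(u) g(u)
    over the N-th descendants u of v.

    The two hypotheses pull in opposite directions. By the second one, T^N makes
    a given finitely supported vector negligible when N = n_k is large. By the
    first one, any target h with finite support is reached from tiny vectors:
    for every m > 0 there is a small z, supported far away, with
    T^N (z^m) = h, while T^N (z^k) is negligible for k > m. Indeed, if the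
    |p_N(u)| add up to a large S over finitely many N-th descendants of v, put
    there an m-th root of (h(v) / S) |p_N| / p_N ([root_perturbation]).

    Each f_i is a rational vector g_i plus an infinite sum of such bumps with
    disjoint supports, bump number s entering f_i as the power z_s^(w_s i)
    ([steerable_generators]). Let P be a non-zero polynomial in d variables
    without constant term. Among the bumps there are infinitely many whose
    weights on the d generators concerned are 1, M, ..., M^(d-1), with M larger
    than the exponents in P. On the support of such a bump z, P(f) is a
    polynomial in z alone, whose lowest term c z^m has c != 0, because exponents
    of distinct monomials have distinct values in base M ([leading_monomial]).
    Supports being disjoint, P(f) splits at that time N into three pieces: the
    part carried by earlier terms, which T^N makes negligible; the part on the
    support of z, sent by T^N close to c h; and the part carried by later bumps,
    chosen small with respect to |T^N|. With h close to t / c, the orbit of P(f)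
    passes close to t ([steerable_hypercyclic]).

    So P(f) is hypercyclic, in particular non-zero: the f_i are algebraically
    independent, and all non-zero elements of the algebra that they generate are
    hypercyclic. The algebra is dense because the f_i already are, the g_i being
    dense and the bumps small. *)

Local Notation nc := Normc.normc.

(** * Modulus, the space c0 and the sup norm *)

Section Modulus.
Context {R : realType}.
Implicit Types x y : R[i].

Lemma nc_ge0 x : 0 <= nc x.
Proof. by case: x => a b /=; exact: sqrtr_ge0. Qed.

Lemma nc0 : nc (0 : R[i]) = 0. Proof. exact: Normc.normc0. Qed.

Lemma nc1 : nc (1 : R[i]) = 1. Proof. exact: Normc.normc1. Qed.

Lemma nc_normE x : `|x| = (nc x)%:C%C.
Proof. by case: x. Qed.

Lemma nc_eq0 x : (nc x == 0) = (x == 0).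
Proof.
by apply/eqP/eqP => [/Normc.eq0_normc //|->]; exact: nc0.
Qed.

Lemma ncM x y : nc (x * y) = nc x * nc y. Proof. exact: Normc.normcM. Qed.

Lemma ncV x : nc x^-1 = (nc x)^-1. Proof. exact: Normc.normcV. Qed.

Lemma ncD x y : nc (x + y) <= nc x + nc y.
Proof. exact: (le_normcD (x : Rcomplex R) y). Qed.

Lemma ncN x : nc (- x) = nc x.
Proof. exact: (normcN (x : Rcomplex R)). Qed.

Lemma nc_dist x y z : nc (x - z) <= nc (x - y) + nc (y - z).
Proof. by rewrite (le_trans _ (ncD _ _)) // addrA subrK. Qed.

Lemma ncX x k : nc (x ^+ k) = nc x ^+ k.
Proof. by elim: k => [|k IH]; rewrite ?expr0 ?nc1 // !exprS ncM IH. Qed.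

Lemma nc_sum (I : Type) (s : seq I) (P : pred I) (F : I -> R[i]) :
  nc (\sum_(i <- s | P i) F i) <= \sum_(i <- s | P i) nc (F i).
Proof.
apply: (big_ind2 (fun (x : R[i]) (y : R) => nc x <= y)).
- by rewrite nc0.
- by move=> x u y v xu yv; rewrite (le_trans (ncD _ _)) // lerD.
- by [].
Qed.

Lemma nc_prod (I : Type) (s : seq I) (P : pred I) (F : I -> R[i]) :
  nc (\prod_(i <- s | P i) F i) = \prod_(i <- s | P i) nc (F i).
Proof. exact: (big_morph _ ncM nc1). Qed.

Lemma nc_real (r : R) : 0 <= r -> nc r%:C%C = r.
Proof. by move=> r0 /=; rewrite expr0n /= addr0 sqrtr_sqr ger0_norm. Qed.

Lemma nc_rect (a b : R) : nc (a +i* b)%C <= `|a| + `|b|.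
Proof.
have -> : (a +i* b)%C = (a +i* 0)%C + (0 +i* b)%C :> R[i].
  by simpc.
rewrite (le_trans (ncD _ _)) //= !expr0n /= addr0 add0r !sqrtr_sqr.
exact: lexx.
Qed.

End Modulus.

Section SupNorm.
Context {R : realType} {A : countType}.
Implicit Types (f g : A -> R[i]) (c : R).

Lemma c0_bounded f : c0 f -> exists2 c, 0 <= c & forall v, nc (f v) <= c.
Proof.
move=> /(_ 1 ltr01)[F finF Ff].
have /finite_fsetP[X FX] := finF.
exists (1 + \sum_(x <- X) nc (f x)).
  by rewrite addr_ge0 ?ler01 // sumr_ge0 // => x _; exact: nc_ge0.
move=> v; have [vX|vX] := boolP (v \in X); last first.
  apply: ler_wpDr; first by rewrite sumr_ge0 // => x _; exact: nc_ge0.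
  by apply/ltW/Ff; rewrite FX /=; exact/negP.
rewrite (big_rem v) //= addrCA lerDl addr_ge0 ?ler01 //.
by rewrite sumr_ge0 // => x _; exact: nc_ge0.
Qed.

Lemma c0_finite (s : seq A) f : (forall v, v \notin s -> f v = 0) -> c0 f.
Proof.
move=> f0 e e0; exists [set` s]; first exact: finite_seq.
by move=> v /negP vs; rewrite f0 // nc0.
Qed.

Lemma c0D f g : c0 f -> c0 g -> c0 (f + g).
Proof.
move=> cf cg e e0; have e2 : 0 < e / 2 by rewrite divr_gt0.
have [F finF Ff] := cf _ e2; have [G finG Gg] := cg _ e2.
exists (F `|` G); first by rewrite finite_setU.
move=> v /not_orP[vF vG]; rewrite (le_lt_trans (ncD _ _)) //.
by rewrite [ltRHS]splitr ltrD ?Ff ?Gg.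
Qed.

Lemma c0M f g : c0 f -> c0 g -> c0 (f * g).
Proof.
move=> cf cg e e0; have [c c_ge0 fc] := c0_bounded cf.
have c1 : 0 < c + 1 by rewrite ltr_wpDl.
have [G finG Gg] := cg (e / (c + 1)) (divr_gt0 e0 c1).
exists G => // v /Gg gv; rewrite [(f * g) v]/(f v * g v) ncM.
rewrite ltr_pdivlMr // in gv; apply: le_lt_trans gv.
by rewrite mulrC ler_wpM2l ?nc_ge0 // (le_trans (fc v)) // lerDl ler01.
Qed.

Lemma c0Z (k : R[i]) f : c0 f -> c0 (k *: f).
Proof.
move=> cf e e0; have c1 : 0 < nc k + 1 by rewrite ltr_wpDl ?nc_ge0.
have [G finG Gg] := cf (e / (nc k + 1)) (divr_gt0 e0 c1).
exists G => // v /Gg gv; rewrite [(k *: f) v]/(k * f v) ncM.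
rewrite ltr_pdivlMr // in gv; apply: le_lt_trans gv.
by rewrite mulrC ler_wpM2l ?nc_ge0 // lerDl ler01.
Qed.

Lemma c0_subalgebra : subalgebra_c0 (@c0 R A).
Proof.
split=> //; [exact: (@c0_finite [::])|exact: c0D|exact: c0Z|exact: c0M].
Qed.

Lemma c0B f g : c0 f -> c0 g -> c0 (f - g).
Proof. by move=> cf cg; rewrite -scaleN1r; apply/c0D/c0Z. Qed.

Lemma le_supnorm f v : c0 f -> nc (f v) <= supnorm f.
Proof.
move=> /c0_bounded[c _ fc]; apply: ub_le_sup; last by exists v.
by exists c => _ [u _ <-].
Qed.

Lemma supnorm_le f c (a : A) : (forall v, nc (f v) <= c) -> supnorm f <= c.
Proof. by move=> fc; apply: ge_sup => [|_ [v _ <-]//]; exists (nc (f a)), a. Qed.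

End SupNorm.

(** * The shift on finitely supported vectors *)

Section Shift.
Context {R : realType} {A : countType} (E : rel A).
Hypothesis treeE : directed_tree E.
Hypothesis unrootedE : unrooted E.
Variable lambda : A -> R[i].
Hypothesis boundedB : bounded_backward_shift E lambda.
Implicit Types (f g : A -> R[i]) (u v : A).

Local Notation B := (backward_shift E lambda).
Local Notation anc N := (iter N (par E)).
Local Notation pw := (path_weight E lambda).

Definition point_mass u (c : R[i]) : A -> R[i] := fun v => if v == u then c else 0.

Lemma edge_par v u : E v u = (par E u == v).
Proof.
have Epar : E (par E u) u.
  by rewrite /par; apply: (@xgetPex _ u [set a | E a u]); exact: unrootedE.
apply/idP/eqP => [Evu|<- //].
exact: (tree_parent_uniq treeE) Epar Evu.
Qed.

Lemma backward_shift_point_mass u c :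
  B (point_mass u c) = point_mass (par E u) (c * lambda u).
Proof.
apply/funext => v; rewrite /backward_shift /summability.sum.
have near_u : summability.totally [set X : {fset A} | u \in X].
  by exists [fset u]%fset => // X /=; rewrite fsub1set.
have totF : ProperFilter (@summability.totally A) := summability.totally_filter.
apply: (@lim_near_cst R[i]^o (@norm_hausdorff R[i] R[i]^o)).
apply: filterS near_u => X /= uX; rewrite /summability.partial_sum.
rewrite -(big_seq_fsetE _ X xpredT (shift_term E lambda (point_mass u c) v)) /=.
have termE w : shift_term E lambda (point_mass u c) v w =
    if w == u then point_mass (par E u) (c * lambda u) v else 0.
  rewrite /shift_term /patch /point_mass.
  have [->|wu] := eqVneq w u; last by rewrite mulr0 if_same.
  have -> : (u \in Chi E v) = (v == par E u).
    by apply/idP/idP; rewrite inE /Chi /= edge_par eq_sym.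
  by rewrite mulrC.
rewrite (big_fsetD1 u uX) termE eqxx big1_fset => [|w]; first exact: addr0.
by rewrite !inE termE => /andP[/negPf->].
Qed.

Lemma backward_shiftD f g : c0 f -> c0 g -> B (f + g) = B f + B g.
Proof.
move=> cf cg; apply/funext => v.
rewrite [RHS]/(B f v + B g v) /backward_shift /summability.sum.
have [cvgB _] := boundedB.
have totF : ProperFilter (@summability.totally A) := summability.totally_filter.
pose term h := shift_term E lambda h v : A -> R[i]^o.
have -> : shift_term E lambda (f + g) v = term f \+ term g.
  apply/funext => w; rewrite /term /shift_term /patch /=.
  by case: ifP => _; [exact: mulrDr|rewrite addr0].
have -> : summability.partial_sum (term f \+ term g) =
    summability.partial_sum (term f) \+ summability.partial_sum (term g).
  by apply/funext => X; rewrite /summability.partial_sum /= -big_split.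
exact: limD (cvgB _ v cf) (cvgB _ v cg).
Qed.

Lemma iter_backward_shift_c0 N f : c0 f -> c0 (iter N B f).
Proof. by move=> cf; elim: N => //= N IH; apply: boundedB.2.1. Qed.

Lemma iter_backward_shiftD N f g : c0 f -> c0 g ->
  iter N B (f + g) = iter N B f + iter N B g.
Proof.
move=> cf cg; elim: N => //= N ->.
by rewrite backward_shiftD //; exact: iter_backward_shift_c0.
Qed.

Lemma path_weightSr N u : pw N.+1 u = lambda u * pw N (par E u).
Proof.
rewrite /path_weight big_ord_recl /=; congr (_ * _).
by apply: eq_bigr => k _; rewrite -iterSr.
Qed.

Lemma iter_backward_shift_point_mass N u c :
  iter N B (point_mass u c) = point_mass (anc N u) (c * pw N u).
Proof.
elim: N u c => [|N IH] u c; first by rewrite /path_weight big_ord0 mulr1.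
by rewrite iterSr backward_shift_point_mass IH -iterSr path_weightSr mulrA.
Qed.

(** On finitely supported vectors everything is explicit: a vertex u has a
    single N-th ancestor, so that its mass moves to that vertex with the factor
    lambda(par^N(u) -> u). The infinite sums in the shift enter the proof only
    through additivity and boundedness. *)
Lemma iter_backward_shift_finite N (Z : seq A) f : uniq Z ->
  (forall u, u \notin Z -> f u = 0) ->
  forall v, iter N B f v = \sum_(u <- Z | anc N u == v) pw N u * f u.
Proof.
have sum_mass (s : seq A) g : uniq s -> (forall u, u \notin s -> g u = 0) ->
    g = \sum_(u <- s) point_mass u (g u).
  elim: s g => [|x s IH] g us g0.
    by rewrite big_nil; apply/funext => u; rewrite g0.
  have /andP[xs uniqs] := us; rewrite big_cons.
  rewrite {1}[g](_ : _ = point_mass x (g x) + (g - point_mass x (g x))); last first.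
    by rewrite addrC subrK.
  have gE w : (g - point_mass x (g x)) w = if w == x then 0 else g w.
    transitivity (g w - point_mass x (g x) w); first by [].
    by rewrite /point_mass; case: eqVneq => [->|_]; rewrite (subrr, subr0).
  congr (_ + _); rewrite [LHS]IH //.
    apply: eq_big_seq => u us'; rewrite gE.
    by have [ux|//] := eqVneq u x; rewrite -ux us' in xs.
  move=> u us'; rewrite gE; have [//|ux] := eqVneq u x.
  by rewrite g0 // inE negb_or ux.
have mass_c0 u c : c0 (point_mass u c).
  apply: (@c0_finite _ _ [:: u]) => w; rewrite inE /point_mass => /negPf ->.
  by [].
have zeroE : iter N B 0 = 0.
  apply/funext => u; have -> : (0 : A -> R[i]) = point_mass u 0.
    by apply/funext => w; rewrite /point_mass if_same.
  by rewrite iter_backward_shift_point_mass mul0r /point_mass !if_same.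
move=> uniqZ f0 v; rewrite {1}(sum_mass Z f uniqZ f0).
have -> : iter N B (\sum_(u <- Z) point_mass u (f u)) =
    \sum_(u <- Z) point_mass (anc N u) (f u * pw N u).
  elim: {uniqZ f0} Z => [|x s IH]; first by rewrite !big_nil.
  rewrite !big_cons iter_backward_shiftD ?IH ?iter_backward_shift_point_mass //.
  by elim/big_ind: _ => //; [exact: (@c0_finite _ _ [::])|exact: c0D].
rewrite fct_sumE /= [RHS]big_mkcond /=.
by apply: eq_bigr => u _; rewrite /point_mass eq_sym mulrC.
Qed.

(** The bound is rounded up to a positive integer, so that the smallness
    conditions of the construction can be recorded by natural numbers. *)
Lemma iter_backward_shift_bounded : exists2 K : nat, (0 < K)%N &
  forall N f c, c0 f -> (forall u, nc (f u) <= c) ->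
    forall v, nc (iter N B f v) <= K%:R ^+ N * c.
Proof.
have [_ [Bc0 [K0 K0P]]] := boundedB.
exists (Num.truncn `|K0|).+1 => // N f c cf fc.
have K0K : K0 <= (Num.truncn `|K0|).+1%:R.
  by rewrite (le_trans (ler_norm _)) // ltW // truncnS_gt.
elim: N => [|N IH] v; first by rewrite expr0 mul1r.
have cN := iter_backward_shift_c0 N cf.
rewrite (le_trans (le_supnorm v (iter_backward_shift_c0 N.+1 cf))) //=.
rewrite (le_trans (K0P _ cN)) // exprS -mulrA.
have sup_le : supnorm (iter N B f) <= (Num.truncn `|K0|).+1%:R ^+ N * c.
  exact: supnorm_le v IH.
have sup_ge0 : 0 <= supnorm (iter N B f).
  exact: le_trans (nc_ge0 _) (le_supnorm v cN).
by rewrite (le_trans (ler_wpM2r sup_ge0 K0K)) // ler_wpM2l.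
Qed.

End Shift.

(** * Steering by small vectors *)

Lemma ler_sum_subset (R : realType) (I : eqType) (s t : seq I) (F : I -> R) :
  uniq s -> {subset s <= t} -> (forall i, 0 <= F i) ->
  \sum_(i <- s) F i <= \sum_(i <- t) F i.
Proof.
move=> us st F0; elim: s t us st => [|x s IH] t /=.
  by rewrite big_nil sumr_ge0.
move=> /andP[xs us] st; have xt : x \in t by apply: st; rewrite mem_head.
rewrite big_cons [leRHS](big_rem x) //= lerD2l IH // => y ys.
have yt : y \in t by apply: st; rewrite inE ys orbT.
have := perm_mem (perm_to_rem xt) y; rewrite yt inE => /esym/orP[/eqP yx|//].
by rewrite yx (negPf xs) in ys.
Qed.

Lemma near_all_seq (T : eqType) (I : Type) (F : set_system I) (FF : Filter F)
    (P : T -> I -> Prop) (s : seq T) :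
  (forall x, x \in s -> \forall k \near F, P x k) ->
  \forall k \near F, forall x, x \in s -> P x k.
Proof.
elim: s => [|x s IH] Ps; first by near=> k.
have Px : \forall k \near F, P x k by apply: Ps; rewrite mem_head.
have Pr : \forall k \near F, forall y, y \in s -> P y k.
  by apply: IH => y ys; apply: Ps; rewrite inE ys orbT.
apply: filterS2 Px Pr => k Pxk Prk y; rewrite inE => /predU1P[->//|].
exact: Prk.
Unshelve. all: by end_near. Qed.

Section Step.
Context {R : realType} {A : countType} (E : rel A).
Hypothesis treeE : directed_tree E.
Hypothesis unrootedE : unrooted E.
Variable lambda : A -> R[i].
Hypothesis lambda_neq0 : forall v, lambda v != 0.
Variable n : nat -> nat.
Hypothesis hsum : forall v : A,
  (\esum_(u in Chin E (n k) v)
     (Normc.normc (path_weight E lambda (n k) u))%:E)%E @[k --> \oo] --> +oo%E.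
Hypothesis hpar : forall v : A,
  path_weight E lambda (n k) v @[k --> \oo] --> (0 : R[i]^o).

Local Notation anc N := (iter N (par E)).
Local Notation pw := (path_weight E lambda).

Lemma Chin_anc N v u : Chin E N v u <-> anc N u = v.
Proof.
elim: N u => [|N IH] u //; rewrite iterSr -IH; split=> [[w Nw wu]|Nu].
  by have := wu; rewrite /Chi /= (edge_par treeE unrootedE) => /eqP->.
by exists (par E u) => //; rewrite /Chi /= (edge_par treeE unrootedE).
Qed.

Lemma path_weight_neq0 N u : pw N u != 0.
Proof. by rewrite prodf_seq_neq0; apply/allP => k _ /=. Qed.

Lemma finite_mass N v (S : R) :
  (S%:E < \esum_(u in Chin E N v) (nc (pw N u))%:E)%E ->
  exists Y : seq A, [/\ uniq Y, forall u, u \in Y -> anc N u = v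
    & S < \sum_(u <- Y) nc (pw N u)].
Proof.
move=> /ereal_sup_gt[_ [X [finX XC] <-]].
rewrite fsbig_finite //= sumEFin lte_fin => ltS.
exists (fset_set X); split=> //; first exact: fset_uniq.
by move=> u; rewrite in_fset_set // inE => /XC /Chin_anc.
Qed.

(** Both hypotheses on (n_k) at one time N = n_k. Removing G from the heavy
    sets of descendants costs at most the mass of G, which is below e by the
    second hypothesis: this is why the bumps can be placed off any finite
    set. *)
Lemma heavy_descendants (H G : seq A) (S e : R) : 0 < e ->
  exists N (Z : seq A),
   [/\ uniq Z, forall u, u \in Z -> u \notin G,
       \sum_(u <- G) nc (pw N u) <= e
     & forall v, v \in H -> S <= \sum_(u <- Z | anc N u == v) nc (pw N u)].
Proof.
move=> e0.
have nearG : \forall k \near \oo, forall u, u \in G ->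
    nc (pw (n k) u) < e / (size G).+1%:R.
  apply: near_all_seq => u _.
  have e1 : 0 < (e / (size G).+1%:R)%:C%C :> R[i] by rewrite ltcR divr_gt0.
  have near_lt := (cvgr0Pnorm_lt (V := R[i]^o) _).1 (hpar u) _ e1.
  apply: filterS (near_lt _) => k.
  by rewrite (nc_normE (pw (n k) u)) ltcR.
have nearH : \forall k \near \oo, forall v, v \in H ->
    ((S + e)%:E < \esum_(u in Chin E (n k) v) (nc (pw (n k) u))%:E)%E.
  by apply: near_all_seq => v _; move/cvgeyPgt: (hsum v); apply.
have [k [Gk Hk]] := filter_ex (filterI nearG nearH).
have /choice[Y YP] : forall v, exists Y : seq A, v \in H ->
    [/\ uniq Y, forall u, u \in Y -> anc (n k) u = v
      & S + e < \sum_(u <- Y) nc (pw (n k) u)].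
  move=> v; have [vH|] := boolP (v \in H); last by exists [::].
  by have [Y ?] := finite_mass (Hk _ vH); exists Y.
have sumG : \sum_(u <- G) nc (pw (n k) u) <= e.
  have : \sum_(u <- G) nc (pw (n k) u) <= \sum_(u <- G) e / (size G).+1%:R.
    by rewrite !big_seq ler_sum // => u /Gk/ltW.
  move=> /le_trans; apply; rewrite big_const_seq count_predT iter_addr_0.
  rewrite -[leLHS]mulr_natr mulrAC ler_pdivrMr ?ltr0Sn // ler_wpM2l ?ler_nat //.
  exact: ltW.
exists (n k), [seq u <- undup (flatten [seq Y v | v <- H]) | u \notin G].
split=> //; first by rewrite filter_uniq ?undup_uniq.
  by move=> u; rewrite mem_filter => /andP[].
move=> v vH; have [uY Yanc ltY] := YP v vH.
rewrite -(lerD2r e) (le_trans (ltW ltY)) // (bigID (mem G)) /= addrC.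
rewrite lerD //.
  rewrite -big_filter -[leRHS]big_filter.
  apply: ler_sum_subset => [|u|u]; [by rewrite filter_uniq| |exact: nc_ge0].
  rewrite !mem_filter mem_undup => /andP[uG uYv]; rewrite uG (Yanc _ uYv) eqxx /=.
  by apply/flattenP; exists (Y v) => //; exact: map_f.
apply: le_trans _ sumG; rewrite -big_filter.
apply: ler_sum_subset => [|u|u]; [by rewrite filter_uniq| |exact: nc_ge0].
by rewrite mem_filter => /andP[].
Qed.

(** The heart of the matter. Let S be the mass of the chosen N-th descendants
    of v. Taking z(u) to be an m-th root of (h(v) / S) |p| / p, where p is the
    weight of the path from v to u, makes the contributions of the p z(u)^m add
    up to h(v). Since |z(u)|^m = |h(v)| / S, a large S makes z small, and the
    sum of the |p| |z(u)|^(m+1) is at most |h(v)| sup |z|: higher powers of z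
    disappear. *)
Lemma root_perturbation (m : nat) (h : A -> R[i]) (H G : seq A) (e : R) :
  (0 < m)%N -> (forall v, v \notin H -> h v = 0) -> 0 < e ->
  exists N (Z : seq A) (z : A -> R[i]),
   [/\ uniq Z, forall u, u \in Z -> u \notin G,
       (forall u, nc (z u) <= e) /\ \sum_(u <- G) nc (pw N u) <= e,
       forall v, \sum_(u <- Z | anc N u == v) pw N u * z u ^+ m = h v
     & forall v, \sum_(u <- Z | anc N u == v) nc (pw N u) * nc (z u) ^+ m.+1 <= e].
Proof.
move=> m0 h0 e0; have [c c0 hc] := c0_bounded (c0_finite h0).
have c1 : 0 < c + 1 by rewrite ltr_wpDl.
(* d bounds |z|; both d <= e and c d <= e are needed, c bounding |h|. *)
pose d := Order.min e (e / (c + 1)).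
have d0 : 0 < d by rewrite lt_min e0 divr_gt0.
have dm : 0 < d ^+ m by rewrite exprn_gt0.
have S0 : 0 < c / d ^+ m + 1 by rewrite ltr_wpDl ?divr_ge0 // ltW.
have [N [Z [uZ ZG Ge ZS]]] := heavy_descendants H G (c / d ^+ m + 1) e0.
pose S v := \sum_(u <- Z | anc N u == v) nc (pw N u).
have S_ge0 v : 0 <= S v by apply: sumr_ge0 => u _; exact: nc_ge0.
have S_gt0 v : v \in H -> 0 < S v by move=> /ZS; exact: lt_le_trans.
pose y u := h (anc N u) / (S (anc N u))%:C%C * ((nc (pw N u))%:C%C / pw N u).
pose z u := m.-root (y u).
have zm u : z u ^+ m = y u by exact: rootCK.
have ncz u : nc (z u) ^+ m = nc (h (anc N u)) / S (anc N u).
  rewrite -ncX zm !ncM !ncV !nc_real ?nc_ge0 // divff ?mulr1 //.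
  by rewrite nc_eq0 path_weight_neq0.
have zd u : nc (z u) <= d.
  rewrite -(ler_pXn2r m0) ?nnegrE ?nc_ge0 ?(ltW d0) // ncz.
  have [vH|vH] := boolP (anc N u \in H); last by rewrite h0 // nc0 mul0r ltW.
  rewrite ler_pdivrMr ?S_gt0 // (le_trans (hc _)) // mulrC -ler_pdivrMr //.
  by rewrite (le_trans _ (ZS _ vH)) // lerDl ler01.
exists N, Z, z; split=> //.
- by split=> // u; rewrite (le_trans (zd u)) // ge_min lexx.
- move=> v; rewrite (eq_bigr (fun u => h v / (S v)%:C%C * (nc (pw N u))%:C%C)).
    rewrite -mulr_sumr -(rmorph_sum (real_complex R)) /= -/(S v).
    have [vH|vH] := boolP (v \in H); last by rewrite h0 // !mul0r.
    rewrite divfK // eq_complex /= eqxx andbT; exact: lt0r_neq0 (S_gt0 _ vH).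
  move=> u /eqP <-; rewrite zm /y mulrCA; congr (_ * _).
  by rewrite mulrC divfK ?path_weight_neq0.
move=> v; have [vH|vH] := boolP (v \in H); last first.
  rewrite big1 ?ltW // => u /eqP uv; rewrite exprSr ncz uv h0 // nc0 mul0r.
  by rewrite !(mul0r, mulr0).
have : \sum_(u <- Z | anc N u == v) nc (pw N u) * nc (z u) ^+ m.+1 <=
    \sum_(u <- Z | anc N u == v) nc (pw N u) * (nc (h v) / S v * d).
  apply: ler_sum => u /eqP uv; rewrite ler_wpM2l ?nc_ge0 // exprSr ncz uv.
  by rewrite ler_wpM2l ?zd // divr_ge0 // nc_ge0.
move=> /le_trans; apply; rewrite -mulr_suml -/(S v) !mulrA.
rewrite (mulrC (S v)) mulfK ?gt_eqF ?S_gt0 //.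
have : nc (h v) * d <= (c + 1) * (e / (c + 1)).
  apply: ler_pM; [exact: nc_ge0|exact: ltW| |by rewrite ge_min lexx orbT].
  by rewrite (le_trans (hc v)) // lerDl.
by rewrite [leRHS]mulrC divfK // gt_eqF.
Qed.

End Step.

(** * Rational vectors and recurrent enumerations *)

Section RationalVectors.
Context {R : realType} {A : countType}.

Definition rational_complex (p : rat * rat) : R[i] :=
  (ratr p.1 +i* ratr p.2)%C.

Definition rational_vector (l : seq (A * (rat * rat))) : A -> R[i] :=
  fun v => rational_complex (nth (0, 0) (unzip2 l) (index v (unzip1 l))).

Lemma rational_vector_out l v : v \notin unzip1 l -> rational_vector l v = 0.
Proof.
move=> vl; rewrite /rational_vector memNindex // nth_default ?size_map //.
by rewrite /rational_complex /= rmorph0.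
Qed.

Lemma rational_complex_dense (x : R[i]) (e : R) : 0 < e ->
  exists p, nc (x - rational_complex p) <= e.
Proof.
case: x => a b e0.
have e2 : 0 < e / 2 by rewrite divr_gt0.
have approx (c : R) : exists q, `|c - ratr q| <= e / 2.
  have lt_c : c - e / 2 < c by rewrite ltrBlDr ltrDl.
  have [q] := rat_in_itvoo lt_c; rewrite in_itv /= => /andP[lt_q q_lt].
  by exists q; rewrite ger0_norm ?subr_ge0 ?(ltW q_lt) // lerBlDr -lerBlDl ltW.
have [p ap] := approx a; have [q bq] := approx b.
exists (p, q).
rewrite -[X in nc X]/((a - ratr p) +i* (b - ratr q))%C.
by rewrite (le_trans (nc_rect _ _)) // [leRHS]splitr lerD.
Qed.

Lemma rational_vector_dense (f : A -> R[i]) (e : R) : c0 f -> 0 < e ->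
  exists l, forall v, nc (f v - rational_vector l v) <= e.
Proof.
move=> cf e0; have [F finF Ff] := cf e e0.
have /finite_seqP[X FX] := finF.
have [q qP] := choice (fun x => @rational_complex_dense x e e0).
exists [seq (v, q (f v)) | v <- X] => v.
rewrite /rational_vector /unzip1 /unzip2 -!map_comp /comp /= map_id.
have [vX|vX] := boolP (v \in X).
  by rewrite (nth_map v) ?index_mem // nth_index.
rewrite memNindex // nth_default ?size_map // /rational_complex /= rmorph0.
by rewrite subr0 ltW // Ff // FX /=; exact/negP.
Qed.

End RationalVectors.

Section Enumeration.
Context {T : countType} (x0 : T).

(** Numbering the pairs (j, x) makes every x occur infinitely often. *)
Definition recurrent_enum (s : nat) : T :=
  odflt x0 (omap snd (choice.unpickle s : option (nat * T))).

Lemma recurrent_enumP (x : T) (s0 : nat) :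
  exists2 s, (s0 <= s)%N & recurrent_enum s = x.
Proof.
pose g (j : nat) := choice.pickle (j, x).
have inj_g : injective g by move=> i j /(pcan_inj choice.pickleK)[].
have [j gj] : exists j, (s0 <= g j)%N.
  apply/not_existsP => small.
  have lt_g (j : 'I_s0.+1) : (g j < s0)%N by rewrite ltnNge; apply/negP/small.
  have inj_G : injective (fun j => Ordinal (lt_g j)).
    by move=> i j [] /inj_g /val_inj.
  by have := leq_card _ inj_G; rewrite !card_ord ltnn.
by exists (g j) => //; rewrite /recurrent_enum choice.pickleK.
Qed.

End Enumeration.

(** * The generators *)

Section Steering.
Context {R : realType} {A : countType} (E : rel A) (lambda : A -> R[i]).

(** At time N, the first d generators live on three disjoint parts of the tree:
    on old they carry a mass that T^N makes negligible; on fresh they are the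
    powers z^(w i) of one bump z, with T^N (z^m) = h and T^N (z^(m+1)) almost
    zero; elsewhere they are so small that not even the factor K^N, which
    bounds T^N, makes them visible. Then T^N sends a polynomial in them, whose
    monomials become z^m and higher powers of z on fresh, close to a multiple
    of h. *)
Record steers (K : nat) (f : nat -> A -> R[i]) (d m : nat) (w : nat -> nat)
    (h : A -> R[i]) (e : R) (N : nat) (old fresh : seq A) (z : A -> R[i]) :
    Prop := Steers {
  old_uniq : uniq old;
  fresh_uniq : uniq fresh;
  fresh_old : forall u, u \in fresh -> u \notin old;
  bump_le : forall u, nc (z u) <= 1;
  generator_fresh : forall i u, (i < d)%N -> u \in fresh -> f i u = z u ^+ w i;
  generator_rest : forall i u, (i < d)%N -> u \notin old -> u \notin fresh ->
    K%:R ^+ N * nc (f i u) <= e;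
  old_weight : \sum_(u <- old) nc (path_weight E lambda N u) <= e;
  fresh_hits : forall v,
    \sum_(u <- fresh | iter N (par E) u == v) path_weight E lambda N u * z u ^+ m
      = h v;
  fresh_higher : forall v,
    \sum_(u <- fresh | iter N (par E) u == v)
      nc (path_weight E lambda N u) * nc (z u) ^+ m.+1 <= e }.

(** The exponents m and w i are shifted by one to be positive, as roots and
    smallness require; weights and targets range over countable types, so that
    a sequence of steps can meet all demands. *)
Definition steerable K f := forall d m (w : seq nat) (l : seq (A * (rat * rat)))
    (e : R), 0 < e ->
  exists N old fresh z,
    steers K f d m.+1 (fun i => (nth 0%N w i).+1) (rational_vector l) e N old fresh z.

End Steering.

Section Generators.
Context {R : realType} {A : countType} (E : rel A).
Hypothesis treeE : directed_tree E.
Hypothesis unrootedE : unrooted E.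
Variable lambda : A -> R[i].
Hypothesis lambda_neq0 : forall v, lambda v != 0.
Variable n : nat -> nat.
Hypothesis hsum : forall v : A,
  (\esum_(u in Chin E (n k) v)
     (Normc.normc (path_weight E lambda (n k) u))%:E)%E @[k --> \oo] --> +oo%E.
Hypothesis hpar : forall v : A,
  path_weight E lambda (n k) v @[k --> \oo] --> (0 : R[i]^o).
Variable K : nat.
Hypothesis K_gt0 : (0 < K)%N.

Local Notation anc N := (iter N (par E)).
Local Notation pw := (path_weight E lambda).

(** Step s serves the demand number s of an enumeration in which all demands
    recur. It adds the power z_s^(w_s i) of a bump z_s to every generator i < s;
    the bump avoids the set G s of vertices used before, and is smaller than
    1 / (L s + 1). The counter L increases so that later bumps are invisible at
    time N s. Generator i starts as the rational vector number i and receives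
    only the bumps s > i, so that it ends up within 1 / (i + 1) of it: as the
    rational vectors recur too, the generators are dense. *)
Lemma steerable_generators : exists f : nat -> A -> R[i],
  [/\ forall i, c0 (f i),
      forall g (e : R), c0 g -> 0 < e -> exists i, forall v, nc (f i v - g v) <= e
    & steerable E lambda K f].
Proof.
pose no_task : nat * seq nat * seq (A * (rat * rat)) := (0%N, [::], [::]).
pose task s := recurrent_enum no_task s.
pose m s := (task s).1.1.
pose w s i := (nth 0%N (task s).1.2 i).+1.
pose l s := (task s).2.
pose g s : A -> R[i] := rational_vector (l s).
have /choice[D DP] : forall x : nat * (seq A * nat),
    exists y : nat * (seq A * (A -> R[i])),
   [/\ uniq y.2.1, forall u, u \in y.2.1 -> u \notin x.2.1,
       (forall u, nc (y.2.2 u) <= x.2.2.+1%:R^-1) /\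
       \sum_(u <- x.2.1) nc (pw y.1 u) <= x.2.2.+1%:R^-1,
       forall v, \sum_(u <- y.2.1 | anc y.1 u == v) pw y.1 u * y.2.2 u ^+ (m x.1).+1
         = g x.1 v
     & forall v, \sum_(u <- y.2.1 | anc y.1 u == v)
         nc (pw y.1 u) * nc (y.2.2 u) ^+ (m x.1).+2 <= x.2.2.+1%:R^-1].
  move=> [s [G L]] /=; have L0 : 0 < L.+1%:R^-1 :> R by rewrite invr_gt0.
  have [N [Z [z ?]]] := root_perturbation treeE unrootedE lambda_neq0 hsum hpar
    G (ltn0Sn (m s)) (@rational_vector_out _ _ (l s)) L0.
  by exists (N, (Z, z)).
pose next s (x : seq A * nat) : seq A * nat :=
  (undup ((D (s, x)).2.1 ++ unzip1 (l s) ++ x.1), (x.2 + K ^ (D (s, x)).1 * s.+1)%N).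
pose st := fix st s := if s is t.+1 then next t (st t) else ([::], 0%N).
pose G s := (st s).1; pose L s := (st s).2.
pose N s := (D (s, st s)).1; pose Z s := (D (s, st s)).2.1.
pose z s := (D (s, st s)).2.2.
have GS s u : u \in G s.+1 = [|| u \in Z s, u \in unzip1 (l s) | u \in G s].
  by rewrite /G /= mem_undup !mem_cat.
have LS s : L s.+1 = (L s + K ^ N s * s.+1)%N by [].
have uG s : uniq (G s) by case: s => // s; exact: undup_uniq.
have G_mono s s' u : (s <= s')%N -> u \in G s -> u \in G s'.
  move=> /subnK <-; elim: (s' - s)%N => // k IH /IH uGk.
  by rewrite addSn GS uGk !orbT.
have L_mono s s' : (s <= s')%N -> (L s <= L s')%N.
  move=> /subnK <-; elim: (s' - s)%N => // k IH.
  by rewrite addSn LS (leq_trans IH) // leq_addr.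
have L_ge s : (s <= L s)%N.
  by elim: s => // s IH; rewrite LS -[leqLHS]addn1 leq_add // muln_gt0 expn_gt0 K_gt0.
have uZ s : uniq (Z s) by have [] := DP (s, st s).
have ZG s u : u \in Z s -> u \notin G s by have [_ /(_ u)] := DP (s, st s).
have z_small s u : nc (z s u) <= (L s).+1%:R^-1.
  by have [_ _ [/(_ u)]] := DP (s, st s).
have inv_mono (a b : nat) : (a <= b)%N -> b.+1%:R^-1 <= a.+1%:R^-1 :> R.
  by move=> ab; rewrite lef_pV2 ?posrE // ler_nat.
have z_le1 s u : nc (z s u) <= 1.
  by rewrite (le_trans (z_small s u)) // (le_trans (inv_mono 0%N _ _)) // invr1.
have z_pow s u i : nc (z s u ^+ w s i) <= nc (z s u).
  by rewrite ncX /w exprS ler_piMr ?nc_ge0 // exprn_ile1 ?nc_ge0.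
have Z_disj s s' u : u \in Z s -> u \in Z s' -> (s < s')%N -> False.
  move=> us us' ss'; have /negP := ZG _ _ us'; apply.
  by apply: G_mono ss' _; rewrite GS us.
(* The bumps have disjoint supports, so that the infinite sum defining f i is
   a choice, at each vertex, of the only relevant term. *)
pose touched i u := [set s | (i < s)%N && (u \in Z s)].
pose f i u := let s := xget 0%N (touched i u) in
  if (i < s)%N && (u \in Z s) then z s u ^+ w s i else g i u.
have f_hit i s u : (i < s)%N -> u \in Z s -> f i u = z s u ^+ w s i.
  move=> i_s us; have ts : touched i u s by rewrite /touched /= i_s us.
  have := xgetPex 0%N (ex_intro _ s ts); rewrite /f.
  set t := xget _ _ => /= it; rewrite it; have /andP[_ ut] := it.
  have [ts'|st'|-> //] := ltngtP t s.
    by case: (Z_disj _ _ _ ut us ts').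
  by case: (Z_disj _ _ _ us ut st').
have f_else i u : (forall s, (i < s)%N -> u \notin Z s) -> f i u = g i u.
  move=> nt; rewrite /f; case: ifP => // /andP[it ut].
  by have := nt _ it; rewrite ut.
have g_out i s u : (i < s)%N -> u \notin G s -> g i u = 0.
  move=> i_s us; apply: rational_vector_out; apply: contra us => ul.
  by apply: G_mono i_s _; rewrite GS ul orbT.
(* Only bumps later than s remain at such a vertex. *)
have f_small i s u : (i < s)%N -> u \notin G s -> u \notin Z s ->
    nc (f i u) <= (L s.+1).+1%:R^-1.
  move=> i_s us uZs; have [[t i_t ut]|nt] := pselect (exists2 t, (i < t)%N & u \in Z t).
    rewrite (f_hit _ _ _ i_t ut) (le_trans (z_pow _ _ _)) //.
    rewrite (le_trans (z_small _ _)) // inv_mono // L_mono //.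
    have [t_s|//|ts] := ltngtP t s; last by rewrite -ts ut in uZs.
    by move: us; rewrite (G_mono _ _ u t_s) // GS ut.
  rewrite f_else => [|t i_t]; last by apply/negP => ut; apply: nt; exists t.
  by rewrite (g_out _ _ _ i_s us) nc0 invr_ge0 ler0n.
have small_step (e : R) s0 : 0 < e -> exists2 t, (s0 <= t)%N &
    forall s, (t <= s)%N -> s.+1%:R^-1 <= e.
  move=> e0; exists (maxn s0 (Num.truncn e^-1)); first exact: leq_maxl.
  move=> s; rewrite geq_max => /andP[_ ts]; rewrite invf_ple ?posrE //.
  by rewrite ltW // (lt_le_trans (truncnS_gt _)) // ler_nat.
exists f; split.
- move=> i e e0; have e2 : 0 < e / 2 by rewrite divr_gt0.
  have [s i_s small] := small_step _ i.+1 e2.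
  exists [set` G s ++ Z s]; first exact: finite_seq.
  move=> u /negP /=; rewrite mem_cat negb_or => /andP[us uZs].
  rewrite (le_lt_trans (f_small i s u i_s us uZs)) //.
  rewrite (@le_lt_trans _ _ (e / 2)) ?ltr_pdivrMr ?ltr_pMr ?ltr1n //.
  by apply: small; rewrite (leq_trans (leqnSn _)) ?L_ge.
- move=> h e ch e0; have e2 : 0 < e / 2 by rewrite divr_gt0.
  have [s _ small] := small_step _ 0%N e2.
  have [lh lhP] := rational_vector_dense ch e2.
  have [i si task_i] := recurrent_enumP no_task (0%N, [::], lh) s.
  exists i => v; rewrite (le_trans (nc_dist _ (g i v) _)) // [leRHS]splitr.
  apply: lerD; last by rewrite -ncN opprB /g /l /task task_i; exact: lhP.
  have [[t i_t vt]|nt] := pselect (exists2 t, (i < t)%N & v \in Z t).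
    rewrite (f_hit _ _ _ i_t vt) (g_out _ _ _ i_t (ZG _ _ vt)) subr0.
    rewrite (le_trans (z_pow _ _ _)) // (le_trans (z_small _ _)) //.
    by apply: small; rewrite (leq_trans si) // (leq_trans (ltnW i_t)).
  rewrite f_else => [|t i_t]; last by apply/negP => vt; apply: nt; exists t.
  by rewrite subrr nc0 ltW.
move=> d mm ww ll e e0.
have [s0 d_s0 small] := small_step _ d e0.
have [s s0_s task_s] := recurrent_enumP no_task (mm, ww, ll) s0.
have ds : (d <= s)%N := leq_trans d_s0 s0_s.
have e_s : (L s).+1%:R^-1 <= e by apply: small; rewrite (leq_trans s0_s).
have [_ _ [_ oldP] hitP highP] := DP (s, st s).
have mE : m s = mm by rewrite /m /task task_s.
exists (N s), (G s), (Z s), (z s); split=> //.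
- by move=> u; exact: ZG.
- move=> i u i_d us; rewrite (f_hit i s u) ?(leq_trans i_d) //.
  by rewrite /w /task task_s.
- move=> i u i_d uG' uZ'; have i_s := leq_trans i_d ds.
  rewrite (le_trans (ler_wpM2l _ (f_small i s u i_s uG' uZ'))) ?exprn_ge0 //.
  apply: le_trans (small s s0_s).
  rewrite ler_pdivrMr // ler_pdivlMl // -natrX -natrM ler_nat LS.
  by rewrite mulnC ltnW // ltnS leq_addl.
- exact: le_trans oldP e_s.
- by move=> v; rewrite -mE (hitP v) /g /l /task task_s.
by move=> v; rewrite -mE (le_trans (highP v)).
Qed.

End Generators.

(** * Polynomials in the generators are hypercyclic *)

Lemma digits_inj (M d : nat) (a b : 'I_d -> nat) :
  (forall i, a i < M)%N -> (forall i, b i < M)%N ->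
  (\sum_(i < d) M ^ i * a i = \sum_(i < d) M ^ i * b i)%N -> a =1 b.
Proof.
elim: d a b => [|d IH] a b aM bM; first by move=> _ [].
have step (c : 'I_d.+1 -> nat) : (\sum_(i < d.+1) M ^ i * c i =
    (\sum_(i < d) M ^ i * c (lift ord0 i)) * M + c ord0)%N.
  rewrite big_ord_recl expn0 mul1n addnC; congr addn; rewrite big_distrl /=.
  by apply: eq_bigr => i _; rewrite /bump leq0n add1n expnS -mulnA [LHS]mulnC.
rewrite !step => eq_ab.
have a0 : a ord0 = b ord0.
  by have := congr1 (modn^~ M) eq_ab; rewrite !modnMDl !modn_small.
have M0 : (0 < M)%N by exact: leq_ltn_trans (aM ord0).
have eq_tl : (fun i => a (lift ord0 i)) =1 (fun i => b (lift ord0 i)).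
  apply: IH => // ; apply/eqP; move/eqP: eq_ab.
  by rewrite a0 eqn_add2r eqn_pmul2r.
by move=> i; case: (unliftP ord0 i) => [j ->|->] //; exact: eq_tl.
Qed.

Lemma seq_argmin (T : eqType) (F : T -> nat) (s : seq T) : s != [::] ->
  exists2 x, x \in s & forall y, y \in s -> (F x <= F y)%N.
Proof.
elim: s => [//|x s IH] _; have [->|/IH[y ys ymin]] := eqVneq s [::].
  by exists x => [|y]; rewrite inE // => /eqP->.
have [xy|/ltnW yx] := leqP (F x) (F y).
  exists x => [|t]; first exact: mem_head.
  by rewrite inE => /predU1P[->//|/ymin]; exact: leq_trans.
exists y => [|t]; first by rewrite inE ys orbT.
by rewrite inE => /predU1P[->//|/ymin].
Qed.

Section Polynomials.
Context {R : realType} (d : nat) (P : mpoly.mpoly d R[i]).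
Hypothesis P0 : mpoly.mcoeff mpoly.mnm0 P = 0.

Definition mpoly_mass : R := \sum_(a <- mpoly.msupp P) nc (mpoly.mcoeff a P).

Lemma mpoly_mass_ge0 : 0 <= mpoly_mass.
Proof. by apply: sumr_ge0 => a _; exact: nc_ge0. Qed.

Lemma msupp_exponent (a : mpoly.multinom d) : a \in mpoly.msupp P ->
  exists i, (0 < a i)%N.
Proof.
move=> aP; apply/not_existsP => a0; move: aP.
have -> : a = mpoly.mnm0.
  apply/mpoly.mnmP => i; rewrite mpoly.mnm0E; apply/eqP.
  by rewrite -leqn0 leqNgt; apply/negP.
by rewrite mpoly.mcoeff_msupp P0 eqxx.
Qed.

(** Without constant term, every monomial contains some x i. *)
Lemma meval_small (x : 'I_d -> R[i]) (r : R) : (forall i, nc (x i) <= r) ->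
  r <= 1 -> nc (mpoly.meval x P) <= mpoly_mass * r.
Proof.
move=> xr r1; rewrite mpoly.mevalE (le_trans (nc_sum _ _ _)) // mulr_suml.
rewrite big_seq [leRHS]big_seq; apply: ler_sum => a /msupp_exponent[i ai].
rewrite ncM ler_wpM2l ?nc_ge0 // nc_prod (bigD1 i) //=.
have le1 j : nc (x j ^+ a j) <= 1.
  by rewrite ncX exprn_ile1 ?nc_ge0 // (le_trans (xr j)).
apply: (@le_trans _ _ (nc (x i ^+ a i))).
  rewrite ler_piMr ?nc_ge0 //; apply: prodr_ile1 => j _.
  by rewrite nc_ge0 le1.
apply: le_trans (xr i); rewrite ncX -(prednK ai) exprS ler_piMr ?nc_ge0 //.
by rewrite exprn_ile1 ?nc_ge0 // (le_trans (xr i)).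
Qed.

Lemma meval_c0 (A : countType) (g : 'I_d -> A -> R[i]) :
  (forall i, c0 (g i)) -> c0 (fun v => mpoly.meval (fun i => g i v) P).
Proof.
move=> cg e e0; have m1 : 0 < mpoly_mass + 1 by rewrite ltr_wpDl ?mpoly_mass_ge0.
pose r := Order.min 1 (e / (mpoly_mass + 1)).
have r0 : 0 < r by rewrite lt_min ltr01 divr_gt0.
have /choice[F FP] : forall i, exists F : set A, finite_set F /\
    forall v, ~ F v -> nc (g i v) < r.
  by move=> i; have [F ? ?] := cg i r r0; exists F.
exists (\bigcup_(i in [set: 'I_d]) F i).
  by apply: bigcup_finite => // i _; exact: (FP i).1.
move=> v vF; apply: (@le_lt_trans _ _ (mpoly_mass * r)).
  apply: meval_small; last by rewrite ge_min lexx.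
  by move=> i; apply/ltW/(FP i).2 => Fv; apply: vF; exists i.
apply: (@lt_le_trans _ _ ((mpoly_mass + 1) * r)).
  by rewrite ltr_pM2r // ltrDl.
by rewrite mulrC -ler_pdivlMr // ge_min lexx orbT.
Qed.

(** Kronecker substitution: x_i = z^(M^i) turns the monomials of P into distinct
    powers of z once M exceeds all exponents, and the lowest power comes from a
    single monomial b. *)
Lemma leading_monomial (M : nat) : P != 0 -> (mpoly.mmeasure mpoly.mdeg P <= M)%N ->
  exists2 b : mpoly.multinom d, b \in mpoly.msupp P &
    (0 < \sum_(i < d) M ^ i * b i)%N /\
    forall a, a \in mpoly.msupp P -> a != b ->
      (\sum_(i < d) M ^ i * b i < \sum_(i < d) M ^ i * a i)%N.
Proof.
move=> Pn0 PM; pose wt (a : mpoly.multinom d) := (\sum_(i < d) M ^ i * a i)%N.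
have digit a i : a \in mpoly.msupp P -> (a i < M)%N.
  move=> aP; apply: leq_trans PM; apply: leq_ltn_trans (mpoly.msize_mdeg_lt aP).
  by rewrite mpoly.mdegE (bigD1 i) //= leq_addr.
have [b bP bmin] : exists2 b : mpoly.multinom d, b \in mpoly.msupp P &
    forall a, a \in mpoly.msupp P -> (wt b <= wt a)%N.
  by apply: seq_argmin; rewrite mpoly.msupp_eq0.
exists b => //; split.
  have [i bi] := msupp_exponent bP.
  have M0 : (0 < M)%N by exact: leq_ltn_trans (digit b i bP).
  by rewrite (bigD1 i) //= addn_gt0 muln_gt0 expn_gt0 M0 bi.
move=> a aP ab; rewrite ltn_neqAle bmin // andbT; apply: contra ab => /eqP wt_eq.
apply/eqP/mpoly.mnmP => i; apply/esym; move: i.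
by apply: (digits_inj _ _ wt_eq) => i; exact: digit.
Qed.

End Polynomials.

(** Each monomial other than the leading one contributes at least one more
    factor z. *)
Lemma meval_power (R : realType) (d M : nat) (P : mpoly.mpoly d R[i])
    (b : mpoly.multinom d) (z : R[i]) (x : 'I_d -> R[i]) :
  b \in mpoly.msupp P ->
  (forall a, a \in mpoly.msupp P -> a != b ->
    (\sum_(i < d) M ^ i * b i < \sum_(i < d) M ^ i * a i)%N) ->
  (forall i : 'I_d, x i = z ^+ (M ^ i)) -> nc z <= 1 ->
  nc (mpoly.meval x P - mpoly.mcoeff b P * z ^+ (\sum_(i < d) M ^ i * b i)%N) <=
    mpoly_mass P * nc z ^+ (\sum_(i < d) M ^ i * b i).+1.
Proof.
move=> bP bmin xz z1; set m := (\sum_i _)%N.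
have powE a : \prod_i x i ^+ a i = z ^+ (\sum_(i < d) M ^ i * a i)%N.
  by rewrite expr_sum; apply: eq_bigr => i _; rewrite xz exprM.
rewrite mpoly.mevalE (bigD1_seq b) ?mpoly.msupp_uniq //= powE -/m.
rewrite [X in nc X]addrC addKr.
rewrite (le_trans (nc_sum _ _ _)) // /mpoly_mass (bigD1_seq b) ?mpoly.msupp_uniq //=.
rewrite mulrDl ler_wpDl ?mulr_ge0 ?exprn_ge0 ?nc_ge0 // mulr_suml.
rewrite big_seq_cond [leRHS]big_seq_cond; apply: ler_sum => a /andP[aP ab].
rewrite powE ncM ler_wpM2l ?nc_ge0 // ncX ler_wiXn2l ?nc_ge0 //.
exact: bmin.
Qed.

Section Hypercyclic.
Context {R : realType} {A : countType} (E : rel A).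
Hypothesis treeE : directed_tree E.
Hypothesis unrootedE : unrooted E.
Variable lambda : A -> R[i].
Hypothesis boundedB : bounded_backward_shift E lambda.
Variable K : nat.
Hypothesis K_gt0 : (0 < K)%N.
Hypothesis K_bound : forall N f c, c0 f -> (forall u, nc (f u) <= c) ->
  forall v, nc (iter N (backward_shift E lambda) f v) <= K%:R ^+ N * c.
Variable f : nat -> A -> R[i].
Hypothesis f_c0 : forall i, c0 (f i).
Hypothesis f_steerable : steerable E lambda K f.

Local Notation B := (backward_shift E lambda).
Local Notation anc N := (iter N (par E)).
Local Notation pw := (path_weight E lambda).

(** To bring the orbit of P(f) near t, steer T^N (z^m) to t / c, where z^m is
    the lowest power obtained by the Kronecker substitution in P and c its
    coefficient. The embedding s of the variables into the generators serves
    both algebraic independence, where it is arbitrary, and the generated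
    algebra, where it is the inclusion. *)
Lemma steerable_hypercyclic (d : nat) (s : 'I_d -> nat) (P : mpoly.mpoly d R[i]) :
  injective s -> mpoly.mcoeff mpoly.mnm0 P = 0 -> P != 0 ->
  HC B (fun v => mpoly.meval (fun i => f (s i) v) P).
Proof.
move=> s_inj P0 Pn0; pose F v := mpoly.meval (fun i => f (s i) v) P.
have cF : c0 F by apply: meval_c0 => // i; exact: f_c0.
split=> // t e ct e0.
pose M := (mpoly.mmeasure mpoly.mdeg P).
have [b bP [m_gt0 bmin]] := leading_monomial P0 Pn0 (leqnn M).
set m := (\sum_i _)%N in m_gt0 bmin.
have c_neq0 : mpoly.mcoeff b P != 0 by rewrite -mpoly.mcoeff_msupp.
set c := mpoly.mcoeff b P in c_neq0.
have M0 : (0 < M)%N by exact: leq_ltn_trans (mpoly.msize_mdeg_lt bP).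
have [C C0 FC] := c0_bounded cF.
pose S := mpoly_mass P; have S0 : 0 <= S := mpoly_mass_ge0 P.
pose D := nc c + C + S + S + 1.
have D0 : 0 < D by rewrite ltr_wpDl // !addr_ge0 // nc_ge0.
(* D r bounds the four errors: approximation of t / c, the part of P(f) on old
   vertices, the higher powers on fresh vertices, and the rest. *)
pose r := Order.min 1 (e / 2 / D).
have r0 : 0 < r by rewrite lt_min ltr01 !divr_gt0.
have r1 : r <= 1 by rewrite ge_min lexx.
have Dr : D * r <= e / 2 by rewrite mulrC -ler_pdivlMr // ge_min lexx orbT.
have [l lP] := rational_vector_dense (c0Z c^-1 ct) r0.
pose dd := (\max_i s i).+1.
(* The weight of generator s i must be M ^ i. *)
pose w := mkseq (fun j => (if [pick i | s i == j] is Some i then M ^ i else 1).-1) dd.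
have wP (i : 'I_d) : ((nth 0 w (s i)).+1 = M ^ i)%N.
  have si : (s i < dd)%N by rewrite ltnS leq_bigmax.
  rewrite nth_mkseq //; case: pickP => [j /eqP/s_inj->|/(_ i)]; last by rewrite eqxx.
  by rewrite prednK // expn_gt0 M0.
have [N [old [fresh [z st]]]] := f_steerable dd m.-1 w l r0.
have [old_uniq fresh_uniq fresh_old z1 f_fresh f_rest old_w hits higher] := st.
rewrite prednK // in hits higher.
pose G u := if u \in old ++ fresh then F u else 0.
have G0 u : u \notin old ++ fresh -> G u = 0 by rewrite /G => /negPf->.
have cG : c0 G := c0_finite G0.
have K0 : 0 < (K%:R : R) ^+ N by rewrite exprn_gt0 // ltr0n.
have HE u : (F - G) u = if u \in old ++ fresh then 0 else F u.
  transitivity (F u - G u) => //.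
  by rewrite /G; case: ifP => _; rewrite (subrr, subr0).
have rest_small v : nc (iter N B (F - G) v) <= S * r.
  have -> : S * r = K%:R ^+ N * (S * (r / K%:R ^+ N)).
    by rewrite [RHS]mulrCA [X in _ = _ * X]mulrC divfK // gt_eqF.
  apply: K_bound; first exact: c0B.
  move=> u; rewrite HE; have [_|] := boolP (u \in old ++ fresh).
    by rewrite nc0 !mulr_ge0 // ?invr_ge0 ltW.
  rewrite mem_cat negb_or => /andP[uo uf].
  apply: meval_small => // [i|].
    by rewrite ler_pdivlMr // mulrC f_rest // ltnS leq_bigmax.
  rewrite ler_pdivrMr // mul1r (le_trans r1) // exprn_ege1 // ler1n.
  exact: K_gt0.
have uniq_of : uniq (old ++ fresh).
  rewrite cat_uniq old_uniq fresh_uniq andbT; apply/hasPn => u.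
  exact: fresh_old.
have old_small v : nc (\sum_(u <- old | anc N u == v) pw N u * G u) <= C * r.
  rewrite (le_trans (nc_sum _ _ _)) //.
  apply: (@le_trans _ _ (\sum_(u <- old | anc N u == v) C * nc (pw N u))).
    apply: ler_sum => u _; rewrite ncM mulrC ler_wpM2r ?nc_ge0 // /G.
    by case: ifP => _; rewrite ?nc0.
  rewrite -mulr_sumr ler_wpM2l // (le_trans _ old_w) //.
  rewrite [leRHS](bigID (fun u => anc N u == v)) /= lerDl sumr_ge0 // => u _.
  exact: nc_ge0.
have fresh_close v : nc (\sum_(u <- fresh | anc N u == v) pw N u * G u -
    c * rational_vector l v) <= S * r.
  rewrite -hits mulr_sumr -sumrB (le_trans (nc_sum _ _ _)) //.
  apply: (@le_trans _ _ (S * \sum_(u <- fresh | anc N u == v)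
      nc (pw N u) * nc (z u) ^+ m.+1)); last by rewrite ler_wpM2l.
  rewrite mulr_sumr big_seq_cond [leRHS]big_seq_cond; apply: ler_sum => u /andP[uf _].
  rewrite /G mem_cat uf orbT mulrCA -mulrBr ncM mulrCA ler_wpM2l ?nc_ge0 //.
  apply: meval_power => // i; rewrite f_fresh ?wP // ltnS leq_bigmax //.
exists (iter N B F); first by exists N.
have [a0 _] := tree_nonempty treeE.
apply: (@le_lt_trans _ _ (e / 2)); last by rewrite ltr_pdivrMr // ltr_pMr // ltr1n.
apply: le_trans Dr; apply: supnorm_le a0 _ => v.
have -> : F = G + (F - G) by rewrite addrC subrK.
rewrite (iter_backward_shiftD boundedB) //; last exact: c0B.
rewrite -[X in nc X]/(iter N B G v + iter N B (F - G) v - t v).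
rewrite (iter_backward_shift_finite treeE unrootedE boundedB N uniq_of G0).
rewrite big_cat /=.
move: (old_small v) (fresh_close v) (rest_small v) (lP v).
set x1 := \sum_(u <- old | _) _; set x2 := \sum_(u <- fresh | _) _.
set x3 := iter N B _ v; set h := rational_vector l v => h1 h2 h3.
rewrite -[X in nc X]/(c^-1 * t v - h) => h4.
have h5 : nc (c * h - t v) <= nc c * r.
  rewrite -ncN opprB -(mulVKf c_neq0 (t v)) -mulrBr ncM ler_wpM2l ?nc_ge0 //.
have -> : x1 + x2 + x3 - t v = x1 + ((x2 - c * h) + (x3 + (c * h - t v))).
  by ring.
rewrite (le_trans (ncD _ _)) // /D !mulrDl mul1r.
have := ncD (x2 - c * h) (x3 + (c * h - t v)); have := ncD x3 (c * h - t v).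
lra.
Qed.

End Hypercyclic.

(** * The generated algebra *)

Section Evaluation.
Context {C : comNzRingType}.

(** This form of the absence of a constant term is visibly stable under the
    operations of an algebra and under changes of variables. *)
Lemma mcoeff0_meval d (P : mpoly.mpoly d C) :
  mpoly.mcoeff mpoly.mnm0 P = mpoly.meval (fun=> 0) P.
Proof.
rewrite mpoly.mevalE.
have zeroE (a : mpoly.multinom d) :
    \prod_(i < d) (0 : C) ^+ a i = (a == mpoly.mnm0)%:R.
  have [->|a0] := eqVneq a mpoly.mnm0.
    by rewrite big1 // => i _; rewrite mpoly.mnm0E expr0.
  have [i ai] : exists i, a i != 0%N.
    apply/not_existsP => a_eq0; move/eqP: a0; apply; apply/mpoly.mnmP => i.
    by rewrite mpoly.mnm0E; apply/eqP; move/negP: (a_eq0 i); rewrite negbK.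
  by rewrite (bigD1 i) //= expr0n (negPf ai) mul0r.
under eq_bigr => a _ do rewrite zeroE.
have [P0|P0] := boolP (mpoly.mnm0 \in mpoly.msupp P).
  rewrite (bigD1_seq mpoly.mnm0) ?mpoly.msupp_uniq //= eqxx mulr1 big1 ?addr0 //.
  by move=> a /negPf ->; rewrite mulr0.
rewrite big_seq big1 => [|a aP]; first exact: mpoly.memN_msupp_eq0.
have [a0|_] := eqVneq a mpoly.mnm0; last by rewrite mulr0.
by rewrite -a0 aP in P0.
Qed.

Lemma meval_widen d D (P : mpoly.mpoly d C) : (d <= D)%N ->
  exists Q : mpoly.mpoly D C, forall x : nat -> C,
    mpoly.meval (fun i => x i) Q = mpoly.meval (fun i => x i) P.
Proof.
move=> dD; exists (mpoly.comp_mpoly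
  [tuple mpoly.mpolyX C (mpoly.mnm1 (widen_ord dD i)) | i < d] P) => x.
rewrite mpoly.comp_mpoly_meval; apply: mpoly.meval_eq => i.
by rewrite tnth_mktuple mpoly.mevalXU.
Qed.

End Evaluation.

Section PolynomialValues.
Context {R : realType} {A : countType} (f : nat -> A -> R[i]).
Hypothesis f_c0 : forall i, c0 (f i).

Definition polynomial_values : set (A -> R[i]) := [set F | exists d
  (P : mpoly.mpoly d R[i]), mpoly.mcoeff mpoly.mnm0 P = 0 /\
    F = (fun v => mpoly.meval (fun i => f i v) P)].

Lemma polynomial_values_subalgebra : subalgebra_c0 polynomial_values.
Proof.
have common F G : polynomial_values F -> polynomial_values G ->
    exists d (P Q : mpoly.mpoly d R[i]),
      [/\ mpoly.meval (fun=> 0) P = 0, mpoly.meval (fun=> 0) Q = 0,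
          F = (fun v => mpoly.meval (fun i => f i v) P)
        & G = (fun v => mpoly.meval (fun i => f i v) Q)].
  move=> [d [P [P0 ->]]] [d' [Q [Q0 ->]]].
  have [P' P'E] := meval_widen P (leq_maxl d d').
  have [Q' Q'E] := meval_widen Q (leq_maxr d d').
  exists (maxn d d'), P', Q'; split.
  - by rewrite (P'E (fun=> 0)) -mcoeff0_meval.
  - by rewrite (Q'E (fun=> 0)) -mcoeff0_meval.
  - by apply/funext => v; rewrite (P'E (fun i => f i v)).
  - by apply/funext => v; rewrite (Q'E (fun i => f i v)).
split.
- by move=> _ [d [P [P0 ->]]]; apply: meval_c0.
- exists 0%N, 0; split; first by rewrite mpoly.mcoeff0.
  by apply/funext => v; rewrite mpoly.meval0.
- move=> F G /common /[apply] -[d [P [Q [P0 Q0 -> ->]]]].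
  exists d, (P + Q); rewrite mcoeff0_meval mpoly.mevalD P0 Q0 addr0; split=> //.
  by apply/funext => v; rewrite mpoly.mevalD.
- move=> c _ [d [P [P0 ->]]]; exists d, (c *: P).
  rewrite mcoeff0_meval mpoly.mevalZ -mcoeff0_meval P0 mulr0; split=> //.
  by apply/funext => v; rewrite mpoly.mevalZ.
- move=> F G /common /[apply] -[d [P [Q [P0 Q0 -> ->]]]].
  exists d, (P * Q); rewrite mcoeff0_meval mpoly.mevalM P0 Q0 mulr0; split=> //.
  by apply/funext => v; rewrite mpoly.mevalM.
Qed.

Lemma generated_polynomial_values :
  smallest subalgebra_c0 (range f) `<=` polynomial_values.
Proof.
apply: smallest_sub; first exact: polynomial_values_subalgebra.
move=> _ [i _ <-]; exists i.+1, (mpoly.mpolyX _ (mpoly.mnm1 ord_max)).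
rewrite mcoeff0_meval mpoly.mevalXU; split=> //.
by apply/funext => v; rewrite mpoly.mevalXU.
Qed.

Lemma generated_subalgebra (G : set (A -> R[i])) : G `<=` c0 ->
  subalgebra_c0 (smallest subalgebra_c0 G).
Proof.
move=> Gc0; split.
- exact: smallest_sub c0_subalgebra Gc0.
- by move=> M [[]].
- move=> F F' GF GF' M MG; have [sM _] := MG.
  by apply: (subalgebra_add sM); [exact: GF|exact: GF'].
- by move=> c F GF M MG; have [sM _] := MG; apply: (subalgebra_scale sM); exact: GF.
- move=> F F' GF GF' M MG; have [sM _] := MG.
  by apply: (subalgebra_mul sM); [exact: GF|exact: GF'].
Qed.

End PolynomialValues.

Lemma hypercyclic_neq0 (R : realType) (A : countType) (T : (A -> R[i]) -> (A -> R[i]))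
    (g : A -> R[i]) (a : A) : T 0 = 0 -> HC T g -> g != 0.
Proof.
move=> T0 [_ dense]; apply/eqP => g0.
pose h : A -> R[i] := fun v => if v == a then 1 else 0.
have ch : c0 h.
  by apply: (@c0_finite _ _ [:: a]) => v; rewrite inE /h => /negPf->.
have [_ [N _ <-]] := dense h 1 ch ltr01.
have -> : iter N T g = 0 by rewrite g0; elim: N => //= N ->.
apply/negP; rewrite -leNgt sub0r.
have cN : c0 (- h) by rewrite -scaleN1r; exact: c0Z.
apply: le_trans (le_supnorm a cN).
by rewrite -[X in nc X]/(- h a) ncN /h eqxx nc1.
Qed.

Theorem theorem4p8 (R : realType) (A : countType) (E : rel A)
    (treeE : directed_tree E) (unrootedE : unrooted E) (leaflessE : leafless E)
    (lambda : A -> R[i]) (lambda_neq0 : forall v, lambda v != 0)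
    (boundedB : bounded_backward_shift E lambda)
    (n : nat -> nat)
    (hsum : forall v : A,
       (\esum_(u in Chin E (n k) v)
           (Normc.normc (path_weight E lambda (n k) u))%:E)%E
         @[k --> \oo] --> +oo%E)
    (hpar : forall v : A,
       path_weight E lambda (n k) v @[k --> \oo] --> (0 : R[i]^o)) :
  exists M : set (A -> R[i]),
    [/\ hypercyclic_algebra (backward_shift E lambda) M,
        dense_c0 M
      & countably_generated_free M].
Proof.
have [K K_gt0 K_bound] := iter_backward_shift_bounded boundedB.
have [f [f_c0 f_dense f_steer]] :=
  steerable_generators treeE unrootedE lambda_neq0 hsum hpar K_gt0.
have [a _] := tree_nonempty treeE.
set B := backward_shift E lambda in K_bound *.
have hyper d (s : 'I_d -> nat) (P : mpoly.mpoly d R[i]) : injective s ->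
    mpoly.mcoeff mpoly.mnm0 P = 0 -> P != 0 ->
    HC B (fun v => mpoly.meval (fun i => f (s i) v) P).
  exact: (steerable_hypercyclic treeE unrootedE boundedB K_gt0 K_bound f_c0 f_steer).
have B0 : B 0 = 0.
  apply/funext => v.
  have := iter_backward_shift_finite treeE unrootedE boundedB 1%N
    (isT : uniq [::]) (fun u _ => erefl : (0 : A -> R[i]) u = 0) v.
  by rewrite big_nil.
have nonzero d (s : 'I_d -> nat) (P : mpoly.mpoly d R[i]) : injective s ->
    mpoly.mcoeff mpoly.mnm0 P = 0 -> P != 0 ->
    (fun v => mpoly.meval (fun i => f (s i) v) P) != 0 :> (A -> R[i]).
  by move=> s_inj P0 Pn0; apply: (hypercyclic_neq0 a B0); exact: hyper.
pose X d (i : 'I_d) : mpoly.mpoly d R[i] := mpoly.mpolyX _ (mpoly.mnm1 i).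
have f_inj : injective f.
  move=> i j fij; apply/eqP; apply/negPn/negP => ij.
  pose s (k : 'I_2) := if k == ord0 then i else j.
  have s_inj : injective s.
    move=> k l; rewrite /s.
    have [->|k0] := eqVneq k ord0; have [->|l0] := eqVneq l ord0 => //.
    - by move=> eij; rewrite eij eqxx in ij.
    - by move=> eij; rewrite eij eqxx in ij.
    move=> _; apply: val_inj; move: k l k0 l0.
    by case=> [[|[|k]] klt] [[|[|l]] llt].
  pose P := X 2%N ord0 - X 2%N ord_max.
  have PE x : mpoly.meval x P = x ord0 - x ord_max.
    by rewrite mpoly.mevalB !mpoly.mevalXU.
  have Pn0 : P != 0.
    apply/eqP => P0; have := PE (fun k => if k == ord0 then 1 else 0).
    by rewrite P0 mpoly.meval0 /= subr0 => /esym/eqP; rewrite oner_eq0.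
  have P0 : mpoly.mcoeff mpoly.mnm0 P = 0 by rewrite mcoeff0_meval PE subrr.
  have /eqP := nonzero _ s P s_inj P0 Pn0; apply; apply/funext => v.
  by rewrite PE /s /= fij subrr.
have rf_c0 : range f `<=` c0 by move=> _ [i _ <-].
have f_gen i : smallest subalgebra_c0 (range f) (f i).
  by apply: sub_gen_smallest; exists i.
exists (smallest subalgebra_c0 (range f)); split.
- split; first exact: generated_subalgebra.
    apply/eqP => M0; have := f_gen 0%N; rewrite M0 /= => f00.
    have X0 : X 1%N ord0 != 0.
      apply/eqP => X0; have := mpoly.mevalXU (fun=> 1 : R[i]) (ord0 : 'I_1).
      rewrite -/(X 1%N ord0) X0 mpoly.meval0 => /esym/eqP.
      by rewrite oner_eq0.
    have inj0 : injective ((fun=> 0%N) : 'I_1 -> nat).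
      by move=> i j _; rewrite !ord1.
    have X00 : mpoly.mcoeff mpoly.mnm0 (X 1%N ord0) = 0.
      by rewrite mcoeff0_meval mpoly.mevalXU.
    have /eqP := nonzero 1%N _ _ inj0 X00 X0; apply.
    by apply/funext => v; rewrite mpoly.mevalXU f00.
  move=> F /(generated_polynomial_values f_c0)[d [P [P0 ->]]].
  have [->|Pn0] := eqVneq P 0; [right|left].
    by apply/funext => v; rewrite mpoly.meval0.
  by apply: (hyper _ val) => //; exact: val_inj.
- move=> h e ch e0; have e2 : 0 < e / 2 by rewrite divr_gt0.
  have [i fi] := f_dense h _ ch e2; exists (f i); first exact: f_gen.
  apply: (@le_lt_trans _ _ (e / 2)); last by rewrite ltr_pdivrMr // ltr_pMr // ltr1n.
  exact: supnorm_le a fi.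
exists (range f); split=> //.
  by apply: inj_card_eq => i j _ _; exact: f_inj.
move=> d g d0 g_inj gf P P0 Pn0.
have /choice[s sP] : forall i, exists k, f k = g i.
  by move=> i; have [k _ fk] := gf i; exists k.
have -> : (fun v => mpoly.meval (fun i => g i v) P) =
    (fun v => mpoly.meval (fun i => f (s i) v) P).
  by apply/funext => v; apply: mpoly.meval_eq => i; rewrite sP.
apply: nonzero => // i j sij; apply: g_inj.
by rewrite -(sP i) -(sP j) sij.
Qed.
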